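(* Let $c>0$ be a given switching cost. Let $u\in\mathbb R^{N\times d}$ be the solution of the quasi-variational inequality $$\min\big(F_i(u),\,u^i-\mathcal M_iu\big)=0,\qquad i\in\mathcal I,$$ and for each $\rho\ge0$ let $u^\rho\in\mathbb R^{N\times d}$ be the solution of the penalized problem $$F_i(u^{\rho})_l-\rho\sum_{j\neq i}\pi\big(u^{\rho,j}_l-c-u^{\rho,i}_l\big)=0,\qquad i\in\mathcal I,\ l\in\mathcal N.$$ Suppose that $F$ is concave, i.e. $F_i(\theta v+(1-\theta)w)\ge\theta F_i(v)+(1-\theta)F_i(w)$ for all $i\in\mathcal I$, $v,w\in\mathbb R^{N\times d}$, $\theta\in[0,1]$, and that there exist positive constants $\tau$ and $\sigma$ such that $\pi(y)\ge\tau y^{1/\sigma}$ for all $0\le y\le 2\|F(0)\|/\gamma$. (1) If $c>2\|F(0)\|/\gamma$, then $u^\rho=u$ for all $\rho\ge0$. (2) If $c\le 2\|F(0)\|/\gamma$, then for any $\kappa\in(0,c)$ there is a function $f:(0,\infty)\to\mathbb R$ such that $$\|u-u^\rho\|\le f(\rho)\ \text{ for all }\rho>0,\qquad f(\rho)\sim-\frac{\sigma\,(C/\tau)^\sigma}{\ln(1-\kappa/L_\kappa)}\,\rho^{-\sigma}\ln\rho\quad\text{as }\rho\to\infty,$$ where $C=\sup_{\|v\|\le\|F(0)\|/\gamma}\|F(v)\|$ and $L_\kappa=(2\|F(0)\|+\kappa)/\gamma$.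
   Context: Let $N\ge1$ and $d\ge 2$ be integers, $\mathcal I=\{1,\dots,d\}$, $\mathcal N=\{1,\dots,N\}$. An element $u\in\mathbb R^{N\times d}$ is written $u=(u^1,\dots,u^d)$ with $u^i\in\mathbb R^N$ and entries $u^i_l$. Inequalities, minima and maxima of vectors/matrices are understood elementwise, and adding or subtracting a scalar acts on every entry. $\|\cdot\|$ is the sup-norm (maximum of absolute values of entries). $f\sim g$ as $\rho\to\infty$ means $\lim_{\rho\to\infty}f(\rho)/g(\rho)=1$. $F=(F_i)_{i\in\mathcal I}:\mathbb R^{N\times d}\to\mathbb R^{N\times d}$ (with $F_i(u)\in\mathbb R^N$) is a continuous function satisfying the monotonicity condition: there is a constant $\gamma>0$ such that for any $u,v\in\mathbb R^{N\times d}$, $i\in\mathcal I$, $l\in\mathcal N$ with $u^i_l-v^i_l=\max_{j\in\mathcal I,k\in\mathcal N}(u^j_k-v^j_k)\ge 0$, one has $F_i(u)_l-F_i(v)_l\ge\gamma(u^i_l-v^i_l)$. $\mathcal M_iu:=\max_{j\ne i}(u^j-c)\in\mathbb R^N$. The penalty function $\pi:\mathbb R\to\mathbb R$ is a continuous non-decreasing function with $\pi|_{(-\infty,0]}=0$ and $\pi|_{(0,\infty)}>0$. The quasi-variational inequality (for $c>0$) and the penalized problem (for $\rho\ge 0$, $c\ge0$) each have a unique solution. *)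

(* Defs.v *)
From HB Require Import structures.
From mathcomp Require Import all_boot all_order all_algebra.
From mathcomp Require Import all_classical all_reals all_analysis.

Set Implicit Arguments.
Unset Strict Implicit.
Unset Printing Implicit Defensive.

Import Order.TTheory GRing.Theory Num.Theory.
Import numFieldNormedType.Exports.

Local Open Scope classical_set_scope.
Local Open Scope ring_scope.

(* An element u of R^{N x d} is a matrix 'M[R]_(N, d): the entry u^i_l is
   [u l i] (column i is the vector u^i), and the entry F_i(u)_l is [F u l i].
   The library norm `|u| on 'M[R]_(N, d) is the sup-norm of the entries. *)

(* Maximum of f over the indices satisfying P.  It is seeded with a value of f
   on P, so that the default of the iterated maximum plays no role; the value 0
   is returned only when P is empty. *)
Definition finmax (R : realType) (I : finType) (P : pred I) (f : I -> R) : R :=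
  if [pick i | P i] is Some i0 then \big[Num.max/f i0]_(i | P i) f i else 0.

Lemma finmaxP (R : realType) (I : finType) (P : pred I) (f : I -> R) (i0 : I) :
  P i0 ->
  (exists2 i, P i & finmax P f = f i) /\ (forall i, P i -> f i <= finmax P f).
Proof.
move=> Pi0; rewrite /finmax; case: pickP => [j Pj|/(_ i0)]; last by rewrite Pi0.
split; last by move=> i Pi; exact: le_bigmax_cond.
elim/big_ind: _ => [|x y [a Pa ->] [b Pb ->]|i Pi]; [by exists j| |by exists i].
by case: (leP (f a) (f b)) => _; [exists b|exists a].
Qed.

Definition monotonicity_condition (R : realType) (N d : nat) (gamma : R)
    (F : 'M[R]_(N, d) -> 'M[R]_(N, d)) : Prop :=
  forall (u v : 'M[R]_(N, d)) (i : 'I_d) (l : 'I_N),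
    u l i - v l i
      = finmax predT (fun p : 'I_N * 'I_d => u p.1 p.2 - v p.1 p.2) ->
    0 <= u l i - v l i ->
    gamma * (u l i - v l i) <= F u l i - F v l i.

Definition concave_map (R : realType) (N d : nat)
    (F : 'M[R]_(N, d) -> 'M[R]_(N, d)) : Prop :=
  forall (i : 'I_d) (l : 'I_N) (v w : 'M[R]_(N, d)) (theta : R),
    0 <= theta <= 1 ->
    theta * F v l i + (1 - theta) * F w l i
      <= F (theta *: v + (1 - theta) *: w) l i.

(* The entry (M_i u)_l; d >= 2 makes the index set {j | j != i} nonempty. *)
Definition switching_max (R : realType) (N d : nat) (c : R)
    (u : 'M[R]_(N, d)) (i : 'I_d) (l : 'I_N) : R :=
  finmax (fun j => j != i) (fun j => u l j - c).

Definition qvi_solution (R : realType) (N d : nat)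
    (F : 'M[R]_(N, d) -> 'M[R]_(N, d)) (c : R) (u : 'M[R]_(N, d)) : Prop :=
  forall (i : 'I_d) (l : 'I_N),
    Num.min (F u l i) (u l i - switching_max c u i l) = 0.

Definition penalty_function (R : realType) (pen : R -> R) : Prop :=
  [/\ continuous pen,
      {homo pen : x y / x <= y},
      (forall x, x <= 0 -> pen x = 0) &
      (forall x, 0 < x -> 0 < pen x)].

Definition penalized_solution (R : realType) (N d : nat)
    (F : 'M[R]_(N, d) -> 'M[R]_(N, d)) (pen : R -> R) (c rho : R)
    (u : 'M[R]_(N, d)) : Prop :=
  forall (i : 'I_d) (l : 'I_N),
    F u l i - rho * \sum_(j < d | j != i) pen (u l j - c - u l i) = 0.

Definition asymp_equiv (R : realType) (f g : R -> R) : Prop :=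
  f rho / g rho @[rho --> +oo] --> (1 : R).

(* Main.v *)
Require Import Defs.
From HB Require Import structures.
From mathcomp Require Import all_boot all_order all_algebra.
From mathcomp Require Import all_classical all_reals all_analysis.
From mathcomp Require Import ring lra.

(** Write [B = |F 0| / gamma], which bounds both [u] and [urho rho].  Monotonicity
    gives a comparison principle, hence [urho rho <= u].  The penalty estimate
    makes [urho rho] a supersolution of the quasi-variational inequality with
    switching cost [c + eps], where [eps = (C / (tau rho))^sigma].  By concavity
    its convex combination with the constant supersolution [B], with weight
    [eps / (c + eps)] on [B], is a supersolution for the cost [c], and so lies
    above [u]: therefore [|u - urho rho| <= 2 B eps / c = O(rho^-sigma)].  This is
    eventually below the prescribed rate of order [rho^-sigma ln rho]. *)

Set Implicit Arguments.
Unset Strict Implicit.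
Unset Printing Implicit Defensive.

Import Order.TTheory GRing.Theory Num.Theory.
Import numFieldNormedType.Exports.

Local Open Scope classical_set_scope.
Local Open Scope ring_scope.


(** * The sup-norm in terms of entries *)

Lemma ler_mx_norm_entry (R : realType) (m n : nat) (x : 'M[R]_(m, n)) i j :
  `|x i j| <= `|x|.
Proof.
rewrite [leRHS]/Num.Def.normr /= mx_normrE.
exact: (le_bigmax _ (fun p : 'I_m * 'I_n => `|x p.1 p.2|) (i, j)).
Qed.

Lemma mx_norm_ler (R : realType) (m n : nat) (x : 'M[R]_(m, n)) (b : R) :
  0 <= b -> (forall i j, `|x i j| <= b) -> `|x| <= b.
Proof.
move=> b0 xb; rewrite [leLHS]/Num.Def.normr /= mx_normrE.
by rewrite (bigmax_le _ b0) // => -[i j] _; exact: xb.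
Qed.

(** * Comparison principle and a priori bounds for monotone maps *)

Section monotone.
Variables (R : realType) (N d : nat) (F : 'M[R]_(N, d) -> 'M[R]_(N, d)).
Variables (gamma : R) (gamma_gt0 : 0 < gamma).
Hypothesis Fmono : monotonicity_condition gamma F.
Implicit Types (u v w : 'M[R]_(N, d)) (i j : 'I_d) (l k : 'I_N).

Lemma monotone_at_argmax u v i l :
  (forall k j, u k j - v k j <= u l i - v l i) -> 0 <= u l i - v l i ->
  gamma * (u l i - v l i) <= F u l i - F v l i.
Proof.
move=> umax; apply: Fmono; apply/le_anti/andP.
have [[p _ maxE] le_max] :=
  @finmaxP R ('I_N * 'I_d)%type predT (fun p => u p.1 p.2 - v p.1 p.2) (l, i) isT.
by split; [exact: (le_max (l, i))|rewrite maxE; exact: umax].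
Qed.

(* Ties between the maximisers of [u - v] are broken in favour of the largest
   entry of [u]: this is what stops the chains of switchings in
   [qvi_le_supersolution]. *)
Lemma monotone_comparison u v :
  (forall i l, (forall k j, u k j - v k j <= u l i - v l i) ->
     (forall k j, u k j - v k j = u l i - v l i -> u k j <= u l i) ->
     0 < u l i - v l i -> F u l i <= F v l i) ->
  forall l i, u l i <= v l i.
Proof.
move=> le_max l0 i0; pose D (p : 'I_N * 'I_d) := u p.1 p.2 - v p.1 p.2.
have [p _ Dp] := @Order.TotalTheory.arg_maxP _ R _ (l0, i0) predT D isT.
have [q /eqP Dq uq] := @Order.TotalTheory.arg_maxP _ R _ p (fun q => D q == D p)
  (fun q => u q.1 q.2) (eqxx _).
rewrite -subr_le0; apply: (le_trans (Dp (l0, i0) isT)); rewrite -Dq.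
rewrite leNgt; apply/negP => Dq0.
have qmax k j : u k j - v k j <= u q.1 q.2 - v q.1 q.2.
  by rewrite -/(D q) Dq; exact: (Dp (k, j)).
have Fuv : F u q.1 q.2 <= F v q.1 q.2.
  apply: le_max => // k j Dkj; apply: (uq (k, j)); apply/eqP.
  by rewrite -Dq /D.
have := monotone_at_argmax qmax (ltW Dq0).
apply/negP; rewrite -ltNge; apply: (@le_lt_trans _ _ 0); first by rewrite subr_le0.
exact: mulr_gt0.
Qed.

Lemma monotone_inj u v : F u = F v -> u = v.
Proof.
move=> Fuv; apply/matrixP => l i; apply/le_anti/andP; split;
  by apply: monotone_comparison => j k *; rewrite Fuv.
Qed.

(** Against [0], every entry of the constant attains the maximal difference, so [F] grows there by
    at least [|F 0|], enough to offset a negative entry of [F 0]. *)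
Lemma const_supersolution l i : 0 <= F (const_mx (`|F 0| / gamma)) l i.
Proof.
have B0 : 0 <= `|F 0| / gamma by rewrite divr_ge0 // ltW.
have := @monotone_at_argmax (const_mx (`|F 0| / gamma)) 0 i l.
rewrite !mxE subr0 mulrCA divff ?gt_eqF // mulr1 => /(_ _ B0) H.
have {}H : `|F 0| <= F (const_mx (`|F 0| / gamma)) l i - F 0 l i.
  by apply: H => k j; rewrite !mxE subr0.
have := ler_mx_norm_entry (F 0) l i; rewrite ler_norml; lra.
Qed.

Lemma const_subsolution l i : F (const_mx (- (`|F 0| / gamma))) l i <= 0.
Proof.
have B0 : 0 <= `|F 0| / gamma by rewrite divr_ge0 // ltW.
have := @monotone_at_argmax 0 (const_mx (- (`|F 0| / gamma))) i l.
rewrite !mxE sub0r opprK mulrCA divff ?gt_eqF // mulr1 => /(_ _ B0) H.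
have {}H : `|F 0| <= F 0 l i - F (const_mx (- (`|F 0| / gamma))) l i.
  by apply: H => k j; rewrite !mxE sub0r opprK.
have := ler_mx_norm_entry (F 0) l i; rewrite ler_norml; lra.
Qed.

(** Shared by both problems: comparison with the constants [B] and [-B]. Where [u - B] is maximal so
    is [u], hence the upper bound needs [F u] to vanish only at the largest entries, from which no
    switching can pay. *)
Lemma solution_bounded u :
  (forall i l, 0 <= F u l i) ->
  (forall i l, (forall k j, u k j <= u l i) -> F u l i = 0) ->
  `|u| <= `|F 0| / gamma.
Proof.
move=> Fu_ge0 Fu_max; apply: mx_norm_ler => [|l i].
  by rewrite divr_ge0 // ltW.
rewrite ler_norml; apply/andP; split.
  suff: (const_mx (- (`|F 0| / gamma)) : 'M[R]_(N, d)) l i <= u l i by rewrite mxE.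
  apply: monotone_comparison => j k _ _ _.
  by rewrite (le_trans (const_subsolution _ _)).
suff: u l i <= (const_mx (`|F 0| / gamma) : 'M[R]_(N, d)) l i by rewrite mxE.
apply: monotone_comparison => j k kj_max _ _.
rewrite Fu_max ?const_supersolution // => k' j'.
by have := kj_max k' j'; rewrite !mxE lerD2r.
Qed.

(* Monotonicity makes [F v l i] nondecreasing in [v l i] and nonincreasing in
   the other entries, so its extrema over the ball are at the corners
   [corner (+-r) (l, i)]. *)
Lemma monotone_has_ubound (r : R) :
  has_ubound [set `|F v| | v in [set v | `|v| <= r]].
Proof.
pose corner (t : R) (p : 'I_N * 'I_d) : 'M[R]_(N, d) :=
  \matrix_(k, j) if (k, j) == p then t else - t.
pose M := \sum_p (`|F (corner r p)| + `|F (corner (- r) p)|).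
exists M => _ [v /= vr <-].
have M0 : 0 <= M by apply: sumr_ge0 => p _; rewrite addr_ge0.
apply: mx_norm_ler => // l i.
have vE k j : - r <= v k j <= r.
  by rewrite -ler_norml (le_trans (ler_mx_norm_entry _ _ _)).
have Mli : `|F (corner r (l, i))| + `|F (corner (- r) (l, i))| <= M.
  rewrite /M (bigD1 (l, i)) //= lerDl; apply: sumr_ge0 => p _.
  by rewrite addr_ge0.
have /andP[v1 v2] := vE l i.
have up : F v l i <= F (corner r (l, i)) l i.
  rewrite -subr_ge0.
  apply: (le_trans _ (@monotone_at_argmax (corner r (l, i)) v i l _ _)).
  - by rewrite !mxE eqxx mulr_ge0 ?(ltW gamma_gt0) // subr_ge0.
  - move=> k j; rewrite !mxE eqxx; case: eqP => [[-> ->]//|_].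
    have /andP[? ?] := vE k j; lra.
  - by rewrite !mxE eqxx subr_ge0.
have dn : F (corner (- r) (l, i)) l i <= F v l i.
  rewrite -subr_ge0.
  apply: (le_trans _ (@monotone_at_argmax v (corner (- r) (l, i)) i l _ _)).
  - by rewrite !mxE eqxx mulr_ge0 ?(ltW gamma_gt0) // subr_ge0.
  - move=> k j; rewrite !mxE eqxx; case: eqP => [[-> ->]//|_].
    have /andP[? ?] := vE k j; lra.
  - by rewrite !mxE eqxx subr_ge0.
have := ler_mx_norm_entry (F (corner r (l, i))) l i.
have := ler_mx_norm_entry (F (corner (- r) (l, i))) l i.
have := normr_ge0 (F (corner r (l, i))).
have := normr_ge0 (F (corner (- r) (l, i))).
rewrite !ler_norml => ? ? /andP[? ?] /andP[? ?]; apply/andP; split; lra.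
Qed.

(** * The quasi-variational inequality *)

Section qvi.
Variables (c : R) (c_gt0 : 0 < c) (d_ge2 : (2 <= d)%N).
Variables (u : 'M[R]_(N, d)) (qvi_u : qvi_solution F c u).

Lemma switching_maxP i l :
  (exists2 j, j != i & switching_max c u i l = u l j - c) /\
  (forall j, j != i -> u l j - c <= switching_max c u i l).
Proof.
have /existsP[j ji] : [exists j : 'I_d, j != i].
  apply: contraLR d_ge2 => /existsPn all_i; rewrite -leqNgt.
  have : (#|'I_d| <= 1)%N.
    by apply/card_le1_eqP => a b _ _; move: (all_i a) (all_i b);
      rewrite !negbK => /eqP -> /eqP ->.
  by rewrite card_ord.
exact: (@finmaxP _ _ (fun j => j != i) (fun j => u l j - c) j ji).
Qed.

Lemma qvi_ge0 i l : 0 <= F u l i.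
Proof. by rewrite -(qvi_u i l) ge_min lexx. Qed.

Lemma qvi_switch i l j : j != i -> u l j - c <= u l i.
Proof.
move=> ji; apply: (le_trans ((switching_maxP i l).2 j ji)).
by rewrite -subr_ge0 -(qvi_u i l) ge_min lexx orbT.
Qed.

Lemma qvi_gt0 i l : 0 < F u l i -> exists2 j, j != i & u l i = u l j - c.
Proof.
move=> Fu_gt0; have [[j ji mE] _] := switching_maxP i l.
exists j => //; apply/eqP; rewrite -mE -subr_eq0; apply/eqP.
have := qvi_u i l; case: leP => // _ Fu0; first by rewrite Fu0 ltxx in Fu_gt0.
Qed.

Lemma qvi_bounded : `|u| <= `|F 0| / gamma.
Proof.
apply: solution_bounded qvi_ge0 _ => i l u_max; apply/le_anti.
rewrite qvi_ge0 andbT leNgt; apply/negP => /qvi_gt0[j _ uE].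
by have := u_max l j; rewrite uE lerBrDr gerDl leNgt c_gt0.
Qed.

(** If [F u l i > 0] at a maximiser of [u - w], then [u l i = u l j - c] for some [j]; the
    constraint on [w] makes [(l, j)] a maximiser too, with a larger entry of [u], against the
    tie-breaking rule. *)
Lemma qvi_le_supersolution w :
  (forall i l, 0 <= F w l i) ->
  (forall i l j, j != i -> w l j - c <= w l i) ->
  forall l i, u l i <= w l i.
Proof.
move=> Fw_ge0 w_switch; apply: monotone_comparison => i l uw_max u_max _.
rewrite (le_trans _ (Fw_ge0 _ _)) // leNgt; apply/negP => /qvi_gt0[j ji uE].
have wj := w_switch i l j ji.
have /u_max : u l j - w l j = u l i - w l i.
  by apply/le_anti; rewrite uw_max /=; lra.
by rewrite uE lerBrDr gerDl leNgt c_gt0.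
Qed.

(* A convex combination of [v] with the constant supersolution, for which the
   switching constraint has slack [c], restores the exact constraint. *)
Lemma qvi_stability (v : 'M[R]_(N, d)) (eps : R) :
  concave_map F -> 0 <= eps ->
  (forall i l, 0 <= F v l i) ->
  (forall i l j, j != i -> v l j - (c + eps) <= v l i) ->
  `|v| <= `|F 0| / gamma ->
  forall l i, u l i - v l i <= eps * (2 * `|F 0| / gamma / c).
Proof.
move=> Fconc eps_ge0 Fv_ge0 v_switch v_le l i.
set B := `|F 0| / gamma in v_le *.
have ce_gt0 : 0 < c + eps by rewrite ltr_wpDr.

(* The weight on [v] that scales its cost [c + eps] down to exactly [c]; the constant [B] adds no
   difference between entries. *)
pose theta := c / (c + eps).
have thetaE : 1 - theta = eps / (c + eps) by rewrite /theta; field; rewrite gt_eqF.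
have theta_ge0 : 0 <= theta by rewrite divr_ge0 // ltW.
have theta'_ge0 : 0 <= 1 - theta by rewrite thetaE divr_ge0 // ltW.
have thetaP : theta * (c + eps) = c by rewrite divfK // gt_eqF.
have := @qvi_le_supersolution (theta *: v + (1 - theta) *: const_mx B) _ _ l i.
rewrite !mxE => uw; have {}uw : u l i <= theta * v l i + (1 - theta) * B.
  apply: uw => [j k|j k h hj].
    apply: le_trans (Fconc j k v (const_mx B) theta _); last first.
      by rewrite theta_ge0 -subr_ge0.
    by rewrite addr_ge0 // mulr_ge0 // const_supersolution.
  rewrite !mxE; have := ler_wpM2l theta_ge0 (v_switch j k h hj).
  by rewrite mulrBr thetaP; lra.
have B_ge0 : 0 <= B by exact: le_trans v_le.
(* By [uw], [u - v <= (1 - theta) * (B - v)], and this lower bound on [v] gives [B - v <= 2 * B]. *)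
have : - B <= v l i.
  by have := le_trans (ler_mx_norm_entry v l i) v_le; rewrite ler_norml => /andP[].
have le_eps : 1 - theta <= eps / c.
  by rewrite thetaE ler_wpM2l // lef_pV2 ?posrE //; lra.
have := ler_wpM2r (mulr_ge0 (ler0n R 2) B_ge0) le_eps.
have -> : eps * (2 * `|F 0| / gamma / c) = eps / c * (2 * B).
  by rewrite /B; ring.
move=> h1 h2; apply: le_trans h1.
have := ler_wpM2l theta'_ge0 h2; lra.
Qed.

(** * The penalized problem *)

Section penalized.
Variables (pen : R -> R) (pen_function : penalty_function pen).
Variables (rho : R) (rho_ge0 : 0 <= rho).
Variables (v : 'M[R]_(N, d)) (pen_v : penalized_solution F pen c rho v).

Lemma penalty_ge0 x : 0 <= pen x.
Proof.
case: pen_function => _ _ pen0 pen_gt0.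
by case: (leP x 0) => [/pen0->//|/pen_gt0/ltW].
Qed.

Lemma penalizedE i l :
  F v l i = rho * \sum_(j < d | j != i) pen (v l j - c - v l i).
Proof. by apply/eqP; rewrite -subr_eq0; apply/eqP; exact: pen_v. Qed.

Lemma penalized_ge0 i l : 0 <= F v l i.
Proof.
by rewrite penalizedE mulr_ge0 // sumr_ge0 // => j _; exact: penalty_ge0.
Qed.

Lemma penalized_eq0 i l :
  (forall j, j != i -> v l j - c <= v l i) -> F v l i = 0.
Proof.
move=> v_switch; rewrite penalizedE big1 ?mulr0 // => j ji.
case: pen_function => _ _ pen0 _; rewrite pen0 // lerBlDr add0r.
exact: v_switch.
Qed.

Lemma penalized_bounded : `|v| <= `|F 0| / gamma.
Proof.
apply: solution_bounded penalized_ge0 _ => i l v_max; apply: penalized_eq0.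
by move=> j _; rewrite lerBlDr ler_wpDr // ltW.
Qed.

(** At a maximiser of [v - u] the switching constraint passes from [u] to [v], so the penalty
    vanishes and [F v = 0 <= F u] there. *)
Lemma penalized_le_qvi l i : v l i <= u l i.
Proof.
move: l i; apply: monotone_comparison => i l vu_max _ _.
rewrite penalized_eq0 ?qvi_ge0 // => j ji.
by have := vu_max l j; have := qvi_switch l ji; lra.
Qed.

(** The penalty of a violation [y > 0] is one term of a nonnegative sum equal to
    [F v l i / rho <= C / rho]; inverting [tau * y^(1/sigma) <= C / rho] bounds [y]. *)
Lemma penalized_switch (C tau sigma : R) :
  0 < tau -> 0 < sigma -> 0 < rho -> `|F v| <= C ->
  (forall y, 0 <= y <= 2 * `|F 0| / gamma -> tau * y `^ (1 / sigma) <= pen y) ->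
  forall i l j, j != i ->
  v l j - (c + (C / tau) `^ sigma * rho `^ (- sigma)) <= v l i.
Proof.
move=> tau_gt0 sigma_gt0 rho_gt0 FvC pen_lb i l j ji.
set eps := _ * _; set y := v l j - c - v l i.
have C_ge0 : 0 <= C by exact: le_trans FvC.
suff : y <= eps by rewrite /y; lra.
have eps_ge0 : 0 <= eps by rewrite mulr_ge0 // powR_ge0.
have [/le_trans->//|y_gt0] := leP y 0.
(* Keeps [y] in the range where the lower bound on [pen] is assumed. *)
have y_le : y <= 2 * `|F 0| / gamma.
  rewrite -mulrA; have v_le k h := le_trans (ler_mx_norm_entry v k h) penalized_bounded.
  have c_ge0 := ltW c_gt0.
  by move: (v_le l j) (v_le l i); rewrite !ler_norml /y => /andP[? ?] /andP[? ?]; lra.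
have pen_y : tau * y `^ (1 / sigma) <= C / rho.
  apply: le_trans (pen_lb y _) _; first by rewrite ltW.
  rewrite ler_pdivlMr // mulrC.
  apply: le_trans (le_trans (ler_norm _) (le_trans (ler_mx_norm_entry (F v) l i) FvC)).
  rewrite penalizedE ler_wpM2l // (bigD1 j) //= lerDl.
  by apply: sumr_ge0 => h _; exact: penalty_ge0.
have {}pen_y : y `^ (1 / sigma) <= C / tau / rho.
  by rewrite mulrAC ler_pdivlMr // mulrC.
have -> : y = (y `^ (1 / sigma)) `^ sigma.
  by rewrite -powRrM divfK ?gt_eqF // powRr1 // ltW.
have -> : eps = (C / tau / rho) `^ sigma.
  rewrite [RHS]powRM ?invr_ge0 ?divr_ge0 ?(ltW tau_gt0) ?(ltW rho_gt0) //.
  by rewrite -(powR_inv1 (ltW rho_gt0)) -powRrM mulN1r.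
apply: ge0_ler_powR => //; first exact: ltW.
  by rewrite nnegrE powR_ge0.
by rewrite nnegrE !divr_ge0 // ltW.
Qed.

End penalized.
End qvi.
End monotone.

(** * The two cost regimes and the asymptotic rate *)

Theorem theorem3p9 (R : realType) (N d : nat) (hN : (1 <= N)%N) (hd : (2 <= d)%N)
  (F : 'M[R]_(N, d) -> 'M[R]_(N, d)) (hFcont : continuous F)
  (gamma : R) (hgamma : 0 < gamma) (hFmono : monotonicity_condition gamma F)
  (hFconc : concave_map F)
  (pen : R -> R) (hpen : penalty_function pen)
  (tau sigma : R) (htau : 0 < tau) (hsigma : 0 < sigma)
  (hpen_lb : forall y : R, 0 <= y <= 2 * `|F 0| / gamma ->
     tau * y `^ (1 / sigma) <= pen y)
  (c : R) (hc : 0 < c)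
  (u : 'M[R]_(N, d)) (hu : qvi_solution F c u)
  (urho : R -> 'M[R]_(N, d))
  (hurho : forall rho : R, 0 <= rho -> penalized_solution F pen c rho (urho rho)) :
  (2 * `|F 0| / gamma < c -> forall rho : R, 0 <= rho -> urho rho = u) /\
  (c <= 2 * `|F 0| / gamma ->
   forall kappa : R, 0 < kappa < c ->
   let C := sup [set `|F v| | v in [set v | `|v| <= `|F 0| / gamma]] in
   let L := (2 * `|F 0| + kappa) / gamma in
   exists f : R -> R,
     (forall rho : R, 0 < rho -> `|u - urho rho| <= f rho) /\
     asymp_equiv f
       (fun rho => - (sigma * (C / tau) `^ sigma / ln (1 - kappa / L))
                   * rho `^ (- sigma) * ln rho)).
Proof.
pose B := `|F 0| / gamma.
have bound2 : 2 * `|F 0| / gamma = B + B by rewrite /B; ring.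
have rho_le rho (rho_ge0 : 0 <= rho) : `|urho rho| <= B.
  exact: (penalized_bounded hgamma hFmono hc hpen rho_ge0 (hurho rho rho_ge0)).
have u_le : `|u| <= B by exact: (qvi_bounded hgamma hFmono hc hd hu).
split=> [c_big rho rho_ge0|c_le kappa /andP[kappa_gt0 kappa_lt] C L].
  (* Entries in [[-B, B]] differ by at most [2 * B < c], so switching is never active and both [u]
     and [urho rho] are zeros of the injective map [F]. *)
  have no_switch (v : 'M[R]_(N, d)) l i j : `|v| <= B -> v l j - c < v l i.
    move=> v_le; have vE k h := le_trans (ler_mx_norm_entry v k h) v_le.
    by move: (vE l j) (vE l i); rewrite !ler_norml => /andP[? ?] /andP[? ?]; lra.
  apply: (monotone_inj hgamma hFmono); apply/matrixP => l i.
  rewrite (penalized_eq0 hpen (hurho rho rho_ge0)) => [|j _]; last first.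
    by rewrite ltW // no_switch // rho_le.
  apply/esym/le_anti; rewrite (qvi_ge0 hu) andbT leNgt; apply/negP.
  move=> /(qvi_gt0 hd hu)[j _ uE].
  by have := no_switch u l i j u_le; rewrite -uE ltxx.
have F0_gt0 : 0 < `|F 0|.
  have : 0 < 2 * `|F 0| / gamma by exact: lt_le_trans c_le.
  by rewrite pmulr_lgt0 ?invr_gt0 // pmulr_rgt0.
have B_gt0 : 0 < B by rewrite divr_gt0.
have F_le_C (v : 'M[R]_(N, d)) : `|v| <= B -> `|F v| <= C.
  move=> v_le; apply: (ub_le_sup (monotone_has_ubound hgamma hFmono _)).
  by exists v.
have C_gt0 : 0 < C by rewrite (lt_le_trans F0_gt0) // F_le_C // normr0 ltW.
pose K := (C / tau) `^ sigma.
have K_gt0 : 0 < K by rewrite powR_gt0 // divr_gt0.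
(* From [kappa < c <= 2 * |F 0| / gamma <= L]; the logarithm is then negative and the prescribed
   rate has a positive coefficient. *)
have q_itv : 0 < 1 - kappa / L < 1.
  have L_gt0 : 0 < L by rewrite divr_gt0 // addr_gt0 // mulr_gt0.
  have kL_gt0 : 0 < kappa / L by rewrite divr_gt0.
  rewrite subr_gt0 ltr_pdivrMr // mul1r gtrBl kL_gt0 andbT.
  rewrite (lt_le_trans kappa_lt) // (le_trans c_le) //.
  by rewrite ler_wpM2r ?invr_ge0 ?(ltW hgamma) // lerDl ltW.
pose lnq := ln (1 - kappa / L).
have lnq_lt0 : lnq < 0 by exact: ln_lt0.
pose g rho := - (sigma * K / lnq) * rho `^ (- sigma) * ln rho.
(* The error is [O(rho^-sigma)], so this maximum is eventually [g rho]. *)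
exists (fun rho => Num.max (g rho) `|u - urho rho|); split=> [rho _|].
  by rewrite le_max lexx orbT.
pose D := 2 * `|F 0| / gamma / c.
have D_ge0 : 0 <= D by rewrite !divr_ge0 ?mulr_ge0 // ltW.
have err rho : 0 < rho -> `|u - urho rho| <= K * rho `^ (- sigma) * D.
  move=> rho_gt0; have rho_ge0 := ltW rho_gt0.
  have eps_ge0 : 0 <= K * rho `^ (- sigma) by rewrite mulr_ge0 ?powR_ge0.
  have pen_rho := hurho rho rho_ge0.
  apply: mx_norm_ler => [|l i]; first exact: mulr_ge0.
  rewrite !mxE ger0_norm; last first.
    by rewrite subr_ge0; apply: (penalized_le_qvi hgamma hFmono hd hu hpen pen_rho).
  apply: (qvi_stability hgamma hFmono hc hd hu) => //.
  - by move=> j k; exact: (penalized_ge0 hpen rho_ge0 pen_rho).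
  - apply: (penalized_switch hgamma hFmono hc hpen rho_ge0 pen_rho) => //.
    by rewrite F_le_C ?rho_le.
  - exact: rho_le.
(* The threshold for [ln rho] beyond which [g rho] dominates the error bound [K * rho^(-sigma) * D].
   Asking for [M + 1] below also makes [ln rho], hence [g rho], positive, so the quotient is exactly
   [1]. *)
pose M := D * (- lnq / sigma).
have M_ge0 : 0 <= M by rewrite mulr_ge0 // divr_ge0 ?oppr_ge0 // ltW.
apply: (@cvg_trans _ ((fun=> 1 : R) @ +oo)); last exact: cvg_cst.
apply: near_eq_cvg; near=> rho.
have rho_ge : expR (M + 1) <= rho.
  by near: rho; apply: nbhs_pinfty_ge; exact: num_real.
have rho_gt0 : 0 < rho by rewrite (lt_le_trans _ rho_ge) ?expR_gt0.
have ln_ge : M + 1 <= ln rho.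
  by rewrite -[leLHS]expRK ler_ln ?posrE ?expR_gt0.
have r_gt0 : 0 < rho `^ (- sigma) by rewrite powR_gt0.
have gE : g rho = K * rho `^ (- sigma) * (sigma / - lnq * ln rho).
  by rewrite /g invrN; ring.
have s_gt0 : 0 < sigma / - lnq by rewrite divr_gt0 ?oppr_gt0.
have ln_gt0 : 0 < ln rho by rewrite (lt_le_trans _ ln_ge) // ltr_wpDl.
have g_gt0 : 0 < g rho by rewrite gE (mulr_gt0 (mulr_gt0 _ _) (mulr_gt0 _ _)).
change (1 = Num.max (g rho) `|u - urho rho| / g rho).
rewrite max_l ?divff ?gt_eqF // (le_trans (err _ rho_gt0)) // gE.
rewrite ler_wpM2l ?mulr_ge0 ?(ltW K_gt0) ?(ltW r_gt0) //.
have -> : D = sigma / - lnq * M.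
  by rewrite /M; field; rewrite (lt_eqF lnq_lt0) (gt_eqF hsigma).
by rewrite ler_wpM2l ?(ltW s_gt0) // (le_trans _ ln_ge) // lerDl.
Unshelve. all: by end_near.
Qed.
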